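(* Let $\alpha$ and $\beta$ be nonzero ordinals. Then the following conditions are equivalent. (a) $X(\beta)$ is not $[\alpha,\alpha]$-compact. (b) There exists an injective function $f:\beta\to\alpha$ such that, for every $K\subseteq\alpha$ with order type $<\alpha$, the set $f^{-1}(K)$ has order type $<\beta$. (c) For every nonempty set $X$ and every nonempty family $\tau$ of subsets of $X$, if $(X,\tau)$ is $[\alpha,\alpha]$-compact, then $(X,\tau)$ is $[\beta,\beta]$-compact.
   Context: For a nonempty set $X$, a nonempty family $\tau$ of subsets of $X$ (not necessarily a topology) and nonzero ordinals $\alpha,\beta$, $(X,\tau)$ is $[\beta,\alpha]$-compact if, whenever $(O_\delta)_{\delta\in\alpha}$ is a sequence of members of $\tau$ (repetitions allowed) with $\bigcup_{\delta\in\alpha}O_\delta=X$, there is $H\subseteq\alpha$ of order type $<\beta$ (in the induced order) with $\bigcup_{\delta\in H}O_\delta=X$. For a nonzero ordinal $\beta$, let $S_\beta(\beta)$ be the set of all functions $f:\beta\to\{0,1\}$ whose support $\{\delta\in\beta\mid f(\delta)=1\}$ has order type $<\beta$. For $\varepsilon\in\beta$ let $Z(\varepsilon)=\{f\in S_\beta(\beta)\mid f(\varepsilon)=0\}$. Then $X(\beta)$ denotes the pair $(S_\beta(\beta),\tau_0)$, where $\tau_0=\{Z(\varepsilon)\mid\varepsilon\in\beta\}$. *)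

(* Defs.v *)
From mathcomp Require Import all_boot all_order all_classical.
From mathcomp Require wochoice.

Set Implicit Arguments.
Unset Strict Implicit.
Unset Printing Implicit Defensive.

Import Order.TTheory.
Local Open Scope classical_set_scope.
Local Open Scope order_scope.

(* Ordinals are represented by well-ordered types: an ordinal is an
   [orderType] whose order satisfies [wochoice.well_order].  The elements of the
   ordinal are the elements of the type. *)
Definition is_ordinal d (A : orderType d) : Prop :=
  @wochoice.well_order A (fun x y : A => x <= y).

(* The order type of H (with the induced order) is < B.  Ordinals below B are
   exactly the proper initial segments of B, so this says that H is
   order-isomorphic to [set y | y < b] for some b in B.  Only the values of
   the function g on H matter. *)
Definition otype_lt dA (A : orderType dA) (H : set A) dB (B : orderType dB)
    : Prop :=
  exists (b : B) (g : A -> B),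
    set_bij H [set y | y < b] g /\
    (forall x y, H x -> H y -> (g x <= g y) = (x <= y)).
Arguments otype_lt {dA A} H {dB} B.

Definition ord_compact dB (B : orderType dB) dA (A : orderType dA)
    (X : Type) (tau : set (set X)) : Prop :=
  forall O : A -> set X,
    (forall i, tau (O i)) ->
    \bigcup_i O i = [set: X] ->
    exists H : set A, otype_lt H B /\ \bigcup_(i in H) O i = [set: X].
Arguments ord_compact {dB} B {dA} A {X} tau.

Definition Sfun d (B : orderType d) : set (B -> bool) :=
  [set f | otype_lt [set i | f i = true] B].
Arguments Sfun {d} B.

(* [Xcar B] (the set S_B(B) as a type) and [Xtau B] form the pair X(B). *)
Definition Xcar d (B : orderType d) : Type := set_type (Sfun B).
Arguments Xcar {d} B.

Definition Zset d (B : orderType d) (e : B) : set (Xcar B) :=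
  [set f : Xcar B | val f e = false].

Definition Xtau d (B : orderType d) : set (set (Xcar B)) :=
  [set Zset e | e in [set: B]].
Arguments Xtau {d} B.

(* Main.v *)
Require Import Defs.
From mathcomp Require Import all_boot all_order all_classical.

(** A point of X(beta) outside every Z(g i), for i in H, is a function equal to
    1 on g(H); there is one exactly when g(H) has order type < beta.  Hence the
    sets Z(g i), for i in H, cover X(beta) exactly when the order type of g(H)
    is beta ([bigcup_Zset_setT]): covers of X(beta) are statements about order
    types of images, and the equivalence is proved around the cycle.

    From (a) to (b): a bad cover (Z(g i)) indexed by alpha says that g(alpha)
    has order type exactly beta while g(H) has order type < beta whenever H has
    order type < alpha.  Enumerating g(alpha) increasingly by beta and choosing
    preimages under g gives the injection.

    From (b) to (c): the range of f cannot have order type < alpha, since its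
    preimage is the whole of beta.  It is thus enumerated increasingly by
    alpha, and composing f with the inverse enumeration makes f a bijection
    ([inj_to_bij]).  A cover indexed by beta is then merely a reindexed cover
    indexed by alpha, and subcovers are carried back by f.

    From (c) to (a): all the Z(e) together cover X, but no subfamily of order
    type < beta does, so X is not [beta, beta]-compact.

    All facts on order types come from the transitive collapse
    ([collapse_exists]), which maps any subset of a well-ordered type
    isomorphically, and without moving any point up, onto an initial segment.
    Consequently a set has order type < B as soon as it has some increasing map
    to B that is strictly bounded ([otype_ltP]). *)

Set Implicit Arguments.
Unset Strict Implicit.
Unset Printing Implicit Defensive.

Import Order.TTheory.
Local Open Scope classical_set_scope.
Local Open Scope order_scope.

(** * Well-ordered types *)

Lemma ordinal_least d (A : orderType d) (P : set A) : is_ordinal A ->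
  P !=set0 -> exists2 z, P z & forall x, P x -> z <= x.
Proof.
move=> wo [x Px].
have [|z [[zP lez] _]] := wo (fun y => `[< P y >]).
  by exists x; apply/asboolP.
by exists z => [|y Py]; [apply/asboolP | apply/lez/asboolP].
Qed.

Lemma ordinal_wf d (A : orderType d) : is_ordinal A ->
  well_founded (fun x y : A => x < y).
Proof.
move=> wo x; apply: contrapT => nx.
pose bad := [set y : A | ~ Acc (fun x y : A => x < y) y].
have [|z nz zmin] := @ordinal_least _ A bad wo.
  by exists x.
apply: nz; constructor => y yz; apply: contrapT => /zmin.
by rewrite leNgt yz.
Qed.

Definition increasing_on dA (A : orderType dA) dB (B : orderType dB)
    (H : set A) (f : A -> B) : Prop :=
  forall x y, H x -> H y -> x < y -> f x < f y.

Lemma increasing_on_le dA (A : orderType dA) dB (B : orderType dB)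
    (H : set A) (f : A -> B) : increasing_on H f ->
  forall x y, H x -> H y -> (f x <= f y) = (x <= y).
Proof.
move=> f_incr x y Hx Hy; case: (leP x y) => [|yx].
  by rewrite le_eqVlt => /orP[/eqP -> | /f_incr/ltW ->] //; rewrite lexx.
by apply/negbTE; rewrite -ltNge f_incr.
Qed.

Lemma increasing_on_inj dA (A : orderType dA) dB (B : orderType dB)
    (H : set A) (f : A -> B) : increasing_on H f ->
  forall x y, H x -> H y -> f x = f y -> x = y.
Proof.
move=> /increasing_on_le f_le x y Hx Hy fxy.
by apply/eqP; rewrite eq_le -!f_le// fxy lexx.
Qed.

Lemma increasing_on_ge_id d (A : orderType d) (f : A -> A) : is_ordinal A ->
  increasing_on [set: A] f -> forall x, x <= f x.
Proof.
move=> /ordinal_wf wf f_incr; elim/(well_founded_ind wf) => x IH.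
by rewrite leNgt; apply/negP => fx; have := IH _ fx; rewrite leNgt f_incr.
Qed.

(** * The transitive collapse and order types *)

(** [c x] is the least element above all [c z] for [z] in [L] below [x].  Since
    [c z <= z] for smaller [z], the point [x] is itself a candidate, so that the
    recursion never leaves [B].  A value [y] below [c x] is not above all these
    [c z], so it is one of them or, by induction, is attained further down. *)
Lemma collapse_exists d (B : orderType d) (L : set B) : is_ordinal B ->
  exists c : B -> B,
    [/\ increasing_on L c, forall x, c x <= x &
        forall x y, y < c x -> exists2 z, L z & c z = y].
Proof.
move=> wo; have wf := ordinal_wf wo.
pose least (P : set B) y := P y /\ forall y', P y' -> y <= y'.
pose body x (rec : forall z, z < x -> B) : B :=
  xget x (least [set y | forall z (zx : z < x), L z -> rec z zx < y]).
pose c := Fix wf (fun=> B) body.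
pose bnd x := [set y | forall z, z < x -> L z -> c z < y].
have cE x : c x = xget x (least (bnd x)).
  rewrite {1}/c Fix_eq// => y f g fg; congr (body y _).
  by apply: functional_extensionality_dep => z;
    apply: functional_extensionality_dep => zy.
have c_least x : bnd x x -> least (bnd x) (c x).
  move=> xb; rewrite cE; apply: xgetPex.
  by have [|y] := @ordinal_least _ B (bnd x) wo; [exists x | exists y].
have c_le x : c x <= x.
  elim/(well_founded_ind wf): x => x IH.
  have xb : bnd x x by move=> z zx _; apply: le_lt_trans (IH _ zx) zx.
  by have [_] := c_least _ xb; apply.
have {}c_least x : least (bnd x) (c x).
  by apply: c_least => z zx _; apply: le_lt_trans (c_le z) zx.
exists c; split=> // [x y Lx _ xy|]; first exact: (c_least y).1.
elim/(well_founded_ind wf) => x IH y ycx.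
have [z [zx Lz]] : exists z, [/\ z < x, L z & y <= c z].
  apply: contrapT => nz; have [_ /(_ y) cx_le] := c_least x.
  suff /cx_le : bnd x y by rewrite leNgt ycx.
  by move=> z zx Lz; rewrite ltNge; apply/negP => ycz; apply: nz; exists z.
rewrite le_eqVlt => /orP[/eqP -> | ycz]; first by exists z.
exact: IH zx _ ycz.
Qed.

(** The collapse of the image of [H] is an initial segment, and a bound on the
    image also bounds its collapse, which only moves points down. *)
Lemma otype_ltP dA (A : orderType dA) dB (B : orderType dB) (H : set A) :
  is_ordinal B ->
  otype_lt H B <->
  exists (b : B) (f : A -> B), increasing_on H f /\ forall x, H x -> f x < b.
Proof.
move=> wo; split=> [[b [g [[gb _ _] g_le]]]|[b [f [f_incr fb]]]].
  exists b, g; split=> // x y Hx Hy.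
  by rewrite !ltNge g_le.
have [c [c_incr c_le c_init]] := collapse_exists (f @` H) wo.
have cf_incr : increasing_on H (c \o f).
  by move=> x y Hx Hy xy; apply: c_incr; [exists x | exists y | apply: f_incr].
have [|b' nb' b'_le] := @ordinal_least _ B [set y | ~ ((c \o f) @` H) y] wo.
  exists b => -[x Hx /= cfx]; have := le_lt_trans (c_le (f x)) (fb _ Hx).
  by rewrite cfx ltxx.
exists b', (c \o f); split; last by apply: increasing_on_le.
split=> [x Hx /=|x y /set_mem Hx /set_mem Hy|y /= yb'].
- rewrite ltNge; apply/negP; rewrite le_eqVlt => /orP[/eqP b'E|].
    by apply: nb'; exists x.
  by move=> /c_init[_ [z Hz <-] czE]; apply: nb'; exists z.
- by move=> cf; apply: (increasing_on_inj cf_incr).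
- apply: contrapT => ny; have /b'_le : ~ ((c \o f) @` H) y by [].
  by rewrite leNgt yb'.
Qed.

Lemma otype_lt_embed dA (A : orderType dA) dA' (A' : orderType dA')
    dB (B : orderType dB) (K : set A) (H : set A') (s : A -> A') :
  is_ordinal B -> increasing_on K s -> (forall x, K x -> H (s x)) ->
  otype_lt H B -> otype_lt K B.
Proof.
move=> wo s_incr sKH /(otype_ltP _ wo)[b [f [f_incr fb]]].
apply/(otype_ltP _ wo); exists b, (f \o s); split=> [x y Kx Ky xy|x Kx] /=.
  by apply: f_incr; [exact: sKH | exact: sKH | exact: s_incr].
exact/fb/sKH.
Qed.

Lemma otype_lt_sub dA (A : orderType dA) dB (B : orderType dB) (K H : set A) :
  is_ordinal B -> K `<=` H -> otype_lt H B -> otype_lt K B.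
Proof. by move=> wo KH; apply: (@otype_lt_embed _ _ _ _ _ _ _ _ id). Qed.

Lemma otype_lt0 dA (A : orderType dA) dB (B : orderType dB) :
  is_ordinal B -> [set: B] !=set0 -> otype_lt (@set0 A) B.
Proof.
by move=> wo [b _]; apply/(otype_ltP _ wo); exists b, (fun=> b); split=> x.
Qed.

Lemma otype_lt_irrefl d (A : orderType d) : is_ordinal A ->
  ~ otype_lt [set: A] A.
Proof.
move=> wo /(otype_ltP _ wo)[b [f [f_incr /(_ b I)]]].
by rewrite ltNge increasing_on_ge_id.
Qed.

(** If the collapse [c] of [H] were not onto, it would be strictly bounded.  So
    it is onto, and its inverse [e] enumerates [H] increasingly. *)
Lemma otype_ge_enum d (A : orderType d) (H : set A) : is_ordinal A ->
  ~ otype_lt H A ->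
  exists c e : A -> A,
    [/\ increasing_on H c, increasing_on [set: A] e, forall x, H (e x),
        cancel e c & forall y, H y -> e (c y) = y].
Proof.
move=> wo nH; have [c [c_incr _ c_init]] := collapse_exists H wo.
have /choice[e eP] : forall y, exists z, H z /\ c z = y.
  move=> y; apply: contrapT => ny; apply: nH; apply/(otype_ltP _ wo).
  exists y, c; split=> // x Hx; rewrite ltNge; apply/negP.
  rewrite le_eqVlt => /orP[/eqP yE|/c_init[z Hz cz]]; apply: ny.
    by exists x.
  by exists z.
have eH x : H (e x) by have [] := eP x.
have eK : cancel e c by move=> x; have [] := eP x.
exists c, e; split=> // [x y _ _ xy|y Hy].
  by rewrite ltNge -(increasing_on_le c_incr)// !eK -ltNge.
by apply: (increasing_on_inj c_incr).
Qed.

(** * Covers of the spaces of functions with small support *)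

(** A point outside the union is a function that is 1 on [g @` H]; conversely,
    when [g @` H] has small order type its indicator is such a point. *)
Lemma bigcup_Zset_setT dB (B : orderType dB) (I : Type) (H : set I)
    (g : I -> B) : is_ordinal B ->
  \bigcup_(i in H) Zset (g i) = [set: Xcar B] <-> ~ otype_lt (g @` H) B.
Proof.
move=> wo; split=> [cov gH|ngH].
  pose f b := `[< (g @` H) b >].
  have fS : Sfun B f.
    apply: otype_lt_sub gH => // b /= /asboolP//.
  have : [set: Xcar B] (exist _ f (mem_set fS)) by [].
  rewrite -cov => -[i Hi]; rewrite /Zset /= => /asboolP; apply.
  by exists i.
apply/seteqP; split=> // x _; apply: contrapT => nx; apply: ngH.
apply: otype_lt_sub (set_valP x) => // _ [i Hi <-] /=.
by apply/negPn/negP => /negbTE xi; apply: nx; exists i.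
Qed.

Lemma Xtau_not_compact dB (B : orderType dB) : is_ordinal B ->
  ~ ord_compact B B (Xtau B).
Proof.
move=> wo /(_ (@Zset _ B)) [i||H [HB]]; first by exists i.
  by apply/(bigcup_Zset_setT _ id wo); rewrite image_id; apply: otype_lt_irrefl.
by move=> /(bigcup_Zset_setT _ id wo); rewrite image_id.
Qed.

(** * The three implications *)

Definition reflects_small da (alpha : orderType da) db (beta : orderType db)
    (f : beta -> alpha) : Prop :=
  forall K : set alpha, otype_lt K alpha -> otype_lt (f @^-1` K) beta.

Lemma not_compact_to_inj da (alpha : orderType da) db (beta : orderType db) :
  is_ordinal beta -> ~ ord_compact alpha alpha (Xtau beta) ->
  exists f : beta -> alpha, injective f /\ reflects_small f.
Proof.
move=> beta_ord /existsNP[O /not_implyP[Otau /not_implyP[Ocov nsub]]].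
have /choice[g gO] : forall i, exists b, Zset b = O i.
  by move=> i; have [b _ <-] := Otau i; exists b.
have OE : O = (fun i => Zset (g i)) by apply/funext => i; rewrite gO.
rewrite {}OE in Ocov nsub.
have g_small (H : set alpha) : otype_lt H alpha -> otype_lt (g @` H) beta.
  move=> Hs; apply: contrapT => /(bigcup_Zset_setT _ _ beta_ord) Hcov.
  by apply: nsub; exists H.
move: Ocov => /(bigcup_Zset_setT _ _ beta_ord) /(otype_ge_enum beta_ord).
move=> [_ [e [_ e_incr e_im _ _]]].
have /choice[f gf] : forall b, exists i, g i = e b.
  by move=> b; have [i _ gi] := e_im b; exists i.
exists f; split=> [b b' fbb'|K /g_small].
  by apply: (increasing_on_inj e_incr); rewrite // -!gf fbb'.
apply: (otype_lt_embed (s := e)) => // [x y _ _|b Kfb]; first exact: e_incr.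
by exists (f b).
Qed.

(** The range of [f] is not small, its preimage being all of [beta]; so it is
    enumerated increasingly by [alpha], and [f] may be relabelled along the
    enumeration. *)
Lemma inj_to_bij da (alpha : orderType da) db (beta : orderType db)
    (f : beta -> alpha) :
  is_ordinal alpha -> is_ordinal beta -> injective f -> reflects_small f ->
  exists h : beta -> alpha, bijective h /\ reflects_small h.
Proof.
move=> alpha_ord beta_ord f_inj f_small.
have /(otype_ge_enum alpha_ord)[c [e [c_incr _ e_im eK cK]]] :
    ~ otype_lt (range f) alpha.
  by move=> /f_small; rewrite preimage_range; apply: otype_lt_irrefl.
have /choice[k fk] : forall a, exists b, f b = e a.
  by move=> a; have [b _ fb] := e_im a; exists b.
exists (c \o f); split=> [|K K_small].
  exists k => [b|a] /=; last by rewrite fk eK.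
  by apply: f_inj; rewrite fk cK//; exists b.
have /f_small : otype_lt (e @` K) alpha.
  apply: (otype_lt_embed (s := c)) K_small => // [x y|_ [a Ka <-]];
    last by rewrite eK.
  by move=> [a _ <-] [a' _ <-]; apply: c_incr.
apply: otype_lt_sub => // b Kcfb; exists (c (f b)) => //.
by rewrite cK//; exists b.
Qed.

(** Bijectivity lets a cover [O] be reindexed as [O \o h^-1] with no index left
    over.  If [h] were merely injective, the remaining indices would need a
    filler set, and a subcover using it could cost one more index in [beta]. *)
Lemma bij_compact_transfer da (alpha : orderType da) db (beta : orderType db)
    (h : beta -> alpha) (X : Type) (tau : set (set X)) :
  bijective h -> reflects_small h ->
  ord_compact alpha alpha tau -> ord_compact beta beta tau.
Proof.
move=> [k hK kK] h_small comp O Otau Ocov.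
have [||H [Hs Hcov]] := comp (O \o k); first by move=> i; apply: Otau.
  rewrite -Ocov; apply/seteqP; split=> x [i _ Oi]; first by exists (k i).
  by exists (h i); rewrite //= hK.
exists (h @^-1` H); split; first exact: h_small.
apply/seteqP; split=> // x _.
have [i Hi Oi] : (\bigcup_(i in H) (O \o k) i) x by rewrite Hcov.
by exists (k i); rewrite //= kK.
Qed.

Theorem theorem5p4
  (da : Order.disp_t) (alpha : orderType da)
  (db : Order.disp_t) (beta : orderType db)
  (alpha_ord : is_ordinal alpha) (beta_ord : is_ordinal beta)
  (alpha_n0 : [set: alpha] !=set0) (beta_n0 : [set: beta] !=set0) :
  [<-> ~ ord_compact alpha alpha (Xtau beta);
       exists f : beta -> alpha, injective f /\
         forall K : set alpha,
           otype_lt K alpha -> otype_lt (f @^-1` K) beta;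
       forall (X : Type) (tau : set (set X)),
         [set: X] !=set0 -> tau !=set0 ->
         ord_compact alpha alpha tau -> ord_compact beta beta tau].
Proof.
tfae.
- exact: not_compact_to_inj.
- move=> [f [f_inj f_small]] X tau _ _.
  have [h [h_bij h_small]] := inj_to_bij alpha_ord beta_ord f_inj f_small.
  exact: bij_compact_transfer h_bij h_small.
- move=> transfer /transfer comp.
  have zeroS : Sfun beta (fun=> false).
    by apply: otype_lt_sub (otype_lt0 _ beta_ord beta_n0).
  apply: (Xtau_not_compact beta_ord); apply: comp.
    by exists (exist _ (fun=> false) (mem_set zeroS)).
  by have [b _] := beta_n0; exists (Zset b), b.
Qed.
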